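(* Let $X$ be the Cayley graph of a finite group, arising from a finite triangular group presentation $\langle S\mid R\rangle$ of that group (i.e. $X$ is the Cayley graph with respect to the generating set $S$). Then $$h(X)\ \ge\ \sqrt{\frac{2}{3|V(X)|}}.$$
   Context: A group presentation is triangular if each relation has length three (as a word in the generators and their inverses). The Cayley graph of a group $G$ with respect to a generating set $S$ has vertex set $G$ and, for each $g\in G$ and $s\in S$, an oriented edge from $g$ to $gs$. $V(X)$ denotes the vertex set of $X$. The Cheeger constant of a finite graph $X$ is $$h(X)=\inf_{A\subset V(X),\ A\ne\emptyset,V(X)}\frac{|\partial A|}{\min(|A|,|V(X)-A|)},$$ where $\partial A$ is the set of edges joining a vertex in $A$ to a vertex not in $A$ (an infimum over the empty set is $+\infty$). *)

(* Defs.v *)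
(* Mathematical Components with MathComp-Analysis. *)
From HB Require Import structures.
From mathcomp Require Import all_boot all_order all_algebra all_fingroup.
From mathcomp Require Import all_classical all_reals all_analysis.

Set Implicit Arguments.
Unset Strict Implicit.
Unset Printing Implicit Defensive.

Import Order.TTheory GRing.Theory Num.Theory.

(* Edges form a type of their own, so loops and parallel edges are allowed and
   every edge is counted separately. *)
Record fingraph := FinGraph {
  vertex : finType;
  edge : finType;
  source : edge -> vertex;
  target : edge -> vertex }.

Definition boundary (X : fingraph) (A : {set vertex X}) : {set edge X} :=
  [set e : edge X | (source e \in A) != (target e \in A)]%SET.

Definition cheeger (R : realType) (X : fingraph) : \bar R :=
  ereal_inf [set x : \bar R | exists A : {set vertex X},
    [/\ A != finset.set0, A != [set: vertex X]%SET &
        x = (#|boundary A|%:R / (minn #|A| #|~: A|)%:R)%R%:E]]%classic.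

(* The letter [(s, false)] stands for the generator [s] and [(s, true)] for its
   formal inverse. Words need not be reduced. *)
Definition letter (S : Type) : Type := (S * bool)%type.
Definition word (S : Type) : Type := seq (letter S).

Definition letter_inv (S : Type) (l : letter S) : letter S := (l.1, ~~ l.2).
Definition word_inv (S : Type) (w : word S) : word S :=
  rev (map (@letter_inv S) w).

(* Equality in the free group on [S]. *)
Inductive free_eq (S : Type) : word S -> word S -> Prop :=
| free_eq_cancel u v l : free_eq (u ++ l :: letter_inv l :: v) (u ++ v)
| free_eq_refl u : free_eq u u
| free_eq_sym u v : free_eq u v -> free_eq v u
| free_eq_trans u v w : free_eq u v -> free_eq v w -> free_eq u w.

(* The words representing elements of the normal closure of [rels] in the free
   group on [S]. *)
Inductive normal_closure (S : eqType) (rels : seq (word S)) : word S -> Prop :=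
| normal_closure_rel r : r \in rels -> normal_closure rels r
| normal_closure_nil : normal_closure rels [::]
| normal_closure_cat u v :
    normal_closure rels u -> normal_closure rels v ->
    normal_closure rels (u ++ v)
| normal_closure_inv u :
    normal_closure rels u -> normal_closure rels (word_inv u)
| normal_closure_conj u v :
    normal_closure rels v -> normal_closure rels (u ++ v ++ word_inv u)
| normal_closure_free u v :
    free_eq u v -> normal_closure rels u -> normal_closure rels v.

Section CayleyGraph.

Variables (gT : finGroupType) (S : finType) (gen : S -> gT).

Definition eval_letter (l : letter S) : gT :=
  (if l.2 then (gen l.1)^-1 else gen l.1)%g.

Definition eval_word (w : word S) : gT := (\prod_(l <- w) eval_letter l)%g.

(* [gen] induces an isomorphism from the free group on [S] modulo the normal
   closure of [rels] onto the whole group [gT]. The notation [\isog Grp] of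
   presentation.v would not do: it only tests finite groups, so it describes
   the finite quotients of the presented group and not that group itself. *)
Definition presents (rels : seq (word S)) : Prop :=
  (forall g : gT, exists w : word S, eval_word w = g) /\
  (forall w : word S, eval_word w = 1%g <-> normal_closure rels w).

Definition triangular (rels : seq (word S)) : bool :=
  all (fun r => size r == 3) rels.

(* One edge for each pair [(g, s)], even if [gen] is not injective. *)
Definition cayley_graph : fingraph :=
  @FinGraph gT (gT * S)%type (fun e => e.1) (fun e => (e.1 * gen e.2)%g).

End CayleyGraph.

(* Main.v *)
Require Import Defs.
From HB Require Import structures.
From mathcomp Require Import all_boot all_order all_algebra all_fingroup.
From mathcomp Require Import all_classical all_reals all_analysis.
From mathcomp Require Import zify lra.

Set Implicit Arguments.
Unset Strict Implicit.
Unset Printing Implicit Defensive.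

Import Order.TTheory GRing.Theory Num.Theory.
Import boot.fintype boot.finset.

(** Suppose that neither [A] nor its complement can be split without enlarging
    the boundary, and that |A| <= |G|/2. The triangles of the presentation fill
    every loop of the Cayley graph, so a part of the boundary of [A] that meets
    every triangle in an even number of edges is a coboundary, hence empty or
    everything. Therefore, if the boundaries of [A] and of a translate [gA] are
    disjoint, then [A] and [gA] are nested up to complements, and comparing
    cardinalities leaves only the case where [A] and [gA] are disjoint. At most
    c^2 elements [g] make the boundaries meet, where c is the size of the
    boundary, and at least |A| elements [g] make [A] and [gA] meet; hence
    |A| <= c^2, and c / |A| >= |A|^(-1/2) >= (2 / |G|)^(1/2). An arbitrary [A] is
    reduced to this case by splitting it or its complement: boundaries are
    additive under splitting, and min(|A|, |G| - |A|) is subadditive. *)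

Section Cuts.

Variables (gT : finGroupType) (S : finType) (gen : S -> gT).
Implicit Types (A B U : {set gT}) (x y g : gT) (w : word S).

(** * Edge boundaries and indecomposable sets *)

Let bd A : {set gT * S} := boundary (X := cayley_graph gen) A.

Lemma mem_bd A (e : gT * S) :
  (e \in bd A) = ((e.1 \in A) != ((e.1 * gen e.2)%g \in A)).
Proof. by rewrite inE. Qed.

Lemma bdC A : bd (~: A) = bd A.
Proof. by apply/setP => e; rewrite !mem_bd !inE; do 2 case: (_ \in A). Qed.

(* Given [B \subset A], the inclusion of boundaries says that no edge joins
   [B] to [A :\: B]. *)
Definition indecomposable A : bool :=
  [forall B : {set gT}, (B \subset A) && (bd B \subset bd A) ==>
    (B == set0) || (B == A)].

Lemma indecomposableP A B : indecomposable A ->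
  B \subset A -> bd B \subset bd A -> B = set0 \/ B = A.
Proof.
move=> /forallP/(_ B) + sBA sbd; rewrite sBA sbd /=.
by case/orP=> /eqP->; [left|right].
Qed.

(** Left multiplication is a label-preserving automorphism of the Cayley graph, because edges are
    right multiplications. *)
Lemma mem_bd_lcoset g A (e : gT * S) :
  (e \in bd (g *: A)%g) = (((g^-1 * e.1)%g, e.2) \in bd A).
Proof. by rewrite !mem_bd /= !mem_lcoset mulgA. Qed.

Lemma indecomposable_lcoset g A :
  indecomposable A -> indecomposable (g *: A)%g.
Proof.
move=> indA; apply/forallP => B; apply/implyP => /andP[sB sbd].
have E : B = (g *: (g^-1 *: B))%g by rewrite -lcosetM mulgV lcoset1.
have [||EB|EB] := @indecomposableP A (g^-1 *: B)%g indA.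
- apply/subsetP => x; rewrite mem_lcoset invgK => /(subsetP sB).
  by rewrite mem_lcoset mulKg.
- apply/subsetP => -[x s]; rewrite mem_bd_lcoset invgK => /(subsetP sbd).
  by rewrite mem_bd_lcoset /= mulKg.
- by apply/orP; left; apply/eqP/setP => x; rewrite E EB mem_lcoset !inE.
- by apply/orP; right; rewrite E EB.
Qed.

Lemma lcosetC g A : (g *: (~: A))%g = ~: (g *: A)%g.
Proof. by apply/setP => x; rewrite !(inE, mem_lcoset). Qed.

Lemma card_bd_split A B : B \subset A -> bd B \subset bd A ->
  #|bd A| = #|bd B| + #|bd (A :\: B)|.
Proof.
move=> sBA sbd; have <- : bd A :\: bd B = bd (A :\: B).
  apply/setP => e; rewrite in_setD !mem_bd !in_setD.
  have := subsetP sbd e; rewrite !mem_bd.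
  have := subsetP sBA e.1; have := subsetP sBA (e.1 * gen e.2)%g.
  by do 4 case: (_ \in _) => //=; move=> h1 h2 h3; rewrite ?h1 ?h2 ?h3.
by rewrite -(cardsID (bd B) (bd A)) (setIidPr sbd).
Qed.

(** * Mod-2 cocycles are coboundaries *)

Section Parity.

(* [q x y] is the value of a mod-2 cochain on an edge with endpoints [x], [y]. *)
Variable q : gT -> gT -> bool.
Hypothesis q_sym : forall x s, q (x * gen s)%g x = q x (x * gen s)%g.

Fixpoint parity x w : bool :=
  if w is l :: w' then
    q x (x * eval_letter gen l)%g (+) parity (x * eval_letter gen l)%g w'
  else false.

Lemma eval_word_cons l w :
  eval_word gen (l :: w) = (eval_letter gen l * eval_word gen w)%g.
Proof. by rewrite /eval_word big_cons. Qed.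

Lemma eval_word_cat u v :
  eval_word gen (u ++ v) = (eval_word gen u * eval_word gen v)%g.
Proof. by rewrite /eval_word big_cat. Qed.

Lemma eval_letter_inv l :
  eval_letter gen (letter_inv l) = (eval_letter gen l)^-1%g.
Proof. by case: l => s [] /=; rewrite /eval_letter //= invgK. Qed.

Lemma q_letter_sym x l :
  q (x * eval_letter gen l)%g x = q x (x * eval_letter gen l)%g.
Proof.
case: l => s []; rewrite /eval_letter /=; last exact: q_sym.
by have := q_sym (x * (gen s)^-1)%g s; rewrite mulgKV.
Qed.

Lemma parity_cat x u v :
  parity x (u ++ v) = parity x u (+) parity (x * eval_word gen u)%g v.
Proof.
elim: u x => [|l u IH] x /=; first by rewrite /eval_word big_nil mulg1.
by rewrite IH eval_word_cons mulgA addbA.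
Qed.

Lemma word_inv_cons l w : word_inv (l :: w) = word_inv w ++ [:: letter_inv l].
Proof. by rewrite /word_inv /= rev_cons cats1. Qed.

Lemma eval_word_inv w : eval_word gen (word_inv w) = (eval_word gen w)^-1%g.
Proof.
elim: w => [|l w IH]; first by rewrite /eval_word !big_nil invg1.
rewrite word_inv_cons eval_word_cat IH !eval_word_cons invMg.
by rewrite {2}/eval_word big_nil mulg1 eval_letter_inv.
Qed.

Lemma parity_inv x w : parity (x * eval_word gen w)%g (word_inv w) = parity x w.
Proof.
elim: w x => [|l w IH] x //=.
rewrite word_inv_cons parity_cat eval_word_inv eval_word_cons mulgA IH.
by rewrite mulgK /= eval_letter_inv mulgK q_letter_sym addbF addbC.
Qed.

Lemma free_eq_parity u v : free_eq u v ->
  eval_word gen u = eval_word gen v /\ forall x, parity x u = parity x v.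
Proof.
elim=> {u v} [u v l|u|u v _ [-> H]|u v w _ [-> H1] _ [-> H2]].
- split=> [|x].
    by rewrite !eval_word_cat !eval_word_cons eval_letter_inv mulKVg.
  by rewrite !parity_cat /= eval_letter_inv mulgK q_letter_sym addKb.
- by [].
- by split=> // x; rewrite H.
- by split=> // x; rewrite H1.
Qed.

(** In the inverse and conjugate cases the parities match only because the given word is a loop, so
    both claims go through one induction. *)
Lemma normal_closure_parity (rels : seq (word S)) w :
  (forall r, r \in rels -> eval_word gen r = 1%g /\ forall x, parity x r = false) ->
  normal_closure rels w ->
  eval_word gen w = 1%g /\ forall x, parity x w = false.
Proof.
move=> Hr; elim=> {w} [r /Hr//||u v _ [eu pu] _ [ev pv]|u _ [eu pu]|u v _ [ev pv]|u v].
- by rewrite /eval_word big_nil.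
- by rewrite eval_word_cat eu ev mulg1; split=> // x; rewrite parity_cat pu pv.
- rewrite eval_word_inv eu invg1; split=> // x.
  by rewrite -(mulg1 x) -eu parity_inv pu.
- rewrite !eval_word_cat eval_word_inv ev mul1g mulgV; split=> // x.
  by rewrite !parity_cat pv ev mulg1 parity_inv addbb.
- by move=> /free_eq_parity[eE pE] _ [eu pu]; rewrite -eE; split=> // x; rewrite -pE.
Qed.

(** All loops have even parity, so the parity of a path from [1] depends only on its endpoint; [B]
    consists of the endpoints of odd parity. *)
Lemma cocycle_coboundary (rels : seq (word S)) : presents gen rels ->
  (forall r, r \in rels -> forall x, parity x r = false) ->
  exists B : {set gT}, forall e, (e \in bd B) = q e.1 (e.1 * gen e.2)%g.
Proof.
move=> [surj ker] Hr.
have loop w : eval_word gen w = 1%g -> forall x, parity x w = false.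
  move=> /ker /normal_closure_parity[]// r rin.
  by split; [apply/ker; exact: normal_closure_rel | exact: Hr].
have parity_eq u v : eval_word gen u = eval_word gen v -> parity 1 u = parity 1 v.
  move=> E; have := loop (u ++ word_inv v).
  rewrite eval_word_cat eval_word_inv E mulgV => /(_ erefl 1%g).
  by rewrite parity_cat E parity_inv; do 2 case: parity.
have /choice[f fE] := surj.
exists [set x | parity 1 (f x)] => -[x s]; rewrite mem_bd !inE /=.
rewrite (@parity_eq (f (x * gen s)%g) (f x ++ [:: (s, false)])).
  rewrite parity_cat /= addbF fE mul1g /eval_letter /=.
  by case: (parity _ _); case: (q _ _).
by rewrite eval_word_cat !fE /eval_word big_cons big_nil mulg1.
Qed.

End Parity.

(** * Cuts with disjoint boundaries *)

(** The generators reach every element, so the Cayley graph is connected. *)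
Lemma bd_eq0 (rels : seq (word S)) A : presents gen rels ->
  bd A = set0 -> A = set0 \/ A = setT.
Proof.
move=> [surj _] bd0.
have step x l : ((x * eval_letter gen l)%g \in A) = (x \in A).
  have E y s : ((y * gen s)%g \in A) = (y \in A).
    have := mem_bd A (y, s); rewrite bd0 inE /= => /esym/negbFE/eqP->//.
  by case: l => s []; rewrite /eval_letter //= -{2}(mulgKV (gen s) x) E.
have reach w x : ((x * eval_word gen w)%g \in A) = (x \in A).
  elim: w x => [|l w IH] x; first by rewrite /eval_word big_nil mulg1.
  by rewrite eval_word_cons mulgA IH step.
case: (boolP (1%g \in A)) => h; [right|left]; apply/setP => x; rewrite !inE.
- by have [w <-] := surj x; rewrite -[eval_word _ _]mul1g reach.
- by have [w <-] := surj x; rewrite -[eval_word _ _]mul1g reach (negbTE h).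
Qed.

(* Two edges of a triangle share a vertex, so a triangle meeting [bd A] in two
   edges has both of them on the same side of [U]: the edges of [bd A] inside
   [U] form a cocycle, hence bound a set [B]. *)
Lemma bd_one_side (rels : seq (word S)) A U :
  triangular rels -> presents gen rels ->
  indecomposable A -> indecomposable (~: A) -> [disjoint bd A & bd U] ->
  {in bd A, forall e, e.1 \in U} \/ {in bd A, forall e, e.1 \notin U}.
Proof.
move=> tri pres indA indC dis.
have agree x s : (x \in A) != ((x * gen s)%g \in A) ->
    (x \in U) = ((x * gen s)%g \in U).
  by have := disjointFr dis (x := (x, s)); rewrite !mem_bd /= => H /H/negbFE/eqP.
pose q x y := ((x \in A) != (y \in A)) && (x \in U).
have q_sym x s : q (x * gen s)%g x = q x (x * gen s)%g.
  by rewrite /q eq_sym; case: eqP => //= /eqP/agree->.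
have agreel x l : (x \in A) != ((x * eval_letter gen l)%g \in A) ->
    (x \in U) = ((x * eval_letter gen l)%g \in U).
  case: l => s []; rewrite /eval_letter /=; last exact: agree.
  by rewrite eq_sym => H; rewrite (@agree (x * (gen s)^-1)%g s) mulgKV.
have [|B bdB] := cocycle_coboundary q_sym pres.
  move=> r rin x; have := allP tri r rin.
  have : eval_word gen r = 1%g by apply/pres.2; exact: normal_closure_rel.
  case: r {rin} => [|l1 [|l2 [|l3 [|]]]] //.
  rewrite !eval_word_cons {1}/eval_word big_nil mulg1 /= => r1 _.
  have := agreel x l1; have := agreel (x * eval_letter gen l1)%g l2.
  have := agreel (x * eval_letter gen l1 * eval_letter gen l2)%g l3.
  have -> : (x * eval_letter gen l1 * eval_letter gen l2 * eval_letter gen l3)%g = x.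
    by rewrite -!mulgA r1 mulg1.
  rewrite /q addbF; do 6 case: (_ \in _) => //=; move=> h1 h2 h3;
    by first [by have := h1 isT | by have := h2 isT | by have := h3 isT].
have sub e : e \in bd B -> e \in bd A by rewrite bdB mem_bd => /andP[].
(* An edge of [bd (B :&: D)] with both ends in [D] would lie in [bd B], hence in [bd A = bd D],
   which is absurd. *)
have subI D : bd D = bd A -> bd (B :&: D) \subset bd D.
  move=> E; apply/subsetP => e; have := sub e; rewrite -E !mem_bd !in_setI.
  by do 4 case: (_ \in _) => //=; move=> h; rewrite h.
have side D : bd D = bd A -> indecomposable D -> B :&: D = set0 \/ B :&: D = D.
  by move=> E /indecomposableP; apply; rewrite ?subsetIr ?subI.
have [in1|in1] : {in bd A, forall e, e \in bd B} \/ {in bd A, forall e, e \notin bd B}.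
- have memD D x : B :&: D = set0 \/ B :&: D = D ->
    ((x \in B) && (x \in D)) = (B :&: D != set0) && (x \in D).
    rewrite -in_setI; case=> E; rewrite E ?eqxx ?inE //.
    by case: eqP => // ->; rewrite inE.
  have HA := fun x => memD _ x (side A erefl indA).
  have HC := fun x => memD _ x (side (~: A) (bdC A) indC).
  (* [B] contains or avoids each of [A] and [~: A]. Equal answers make [bd B] empty; different ones
     make [B] equal to [A] or [~: A]. *)
  case: (boolP ((B :&: A != set0) == (B :&: ~: A != set0))) => h; [right|left];
    move=> e; rewrite !mem_bd; have := HA e.1; have := HC e.1;
    have := HA (e.1 * gen e.2)%g; have := HC (e.1 * gen e.2)%g;
    rewrite !in_setC; move: h; do 2 case: (_ != set0) => //=;
    by do 4 case: (_ \in _).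
- by left=> e ein; have := in1 e ein; rewrite bdB => /andP[].
- right=> e ein; have := in1 e ein; rewrite bdB /q.
  by move: ein; rewrite mem_bd => ->.
Qed.

Lemma bd_disjoint_nested (rels : seq (word S)) A U :
  triangular rels -> presents gen rels ->
  indecomposable A -> indecomposable (~: A) ->
  indecomposable U -> indecomposable (~: U) -> [disjoint bd A & bd U] ->
  [\/ [disjoint U & A], U \subset A, A \subset U | ~: U \subset A].
Proof.
move=> tri pres indA indC indU indCU dis.
(* No edge of [bd A] has an end in [D], so an edge leaving [D :&: A] must leave [D]. *)
have meet D : bd D = bd U -> indecomposable D ->
    {in bd A, forall e, e.1 \notin D} -> D :&: A = set0 \/ D :&: A = D.
  move=> E indD out; apply: indecomposableP => //; first exact: subsetIl.
  apply/subsetP => e; have := disjointFr dis (x := e); rewrite -E.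
  have := out e; rewrite !mem_bd !in_setI.
  by do 4 case: (_ \in _) => //=; move=> h1 h2; have := h1 isT; have := h2 isT.
have [inU|outU] := bd_one_side tri pres indA indC dis.
- have [|E|E] := meet (~: U) (bdC U) indCU.
  + by move=> e /inU; rewrite in_setC negbK.
  + by constructor 3; rewrite -(setCK U) -disjoints_subset -setI_eq0 setIC E.
  + by constructor 4; apply/setIidPl.
- have [E|E] := meet U erefl indU outU.
  + by constructor 1; rewrite -setI_eq0 E.
  + by constructor 2; apply/setIidPl.
Qed.

(** * Counting translates and the isoperimetric inequality *)

Lemma exists_translate A : #|bd A| ^ 2 < #|A| ->
  exists g, ~~ [disjoint (g *: A)%g & A] /\ [disjoint bd A & bd (g *: A)%g].
Proof.
move=> lt; have /card_gt0P[y yA] : 0 < #|A| by lia.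
(* If [bd A] and its translate by [g] share an edge, then [g] is a quotient of the sources of two
   edges of [bd A]. For fixed [y], the [#|A|] elements [x * y^-1] cannot all be such quotients. *)
pose bad := [set (p.1.1 * p.2.1^-1)%g | p in setX (bd A) (bd A)].
have /subsetPn[g] : ~~ ([set (x * y^-1)%g | x in A] \subset bad).
  apply/negP => /subset_leq_card; rewrite card_imset; last exact: mulIg.
  move=> le; have := leq_trans le (leq_imset_card _ _).
  by rewrite cardsX mulnn leqNgt lt.
move=> /imsetP[x xA ->] nbad; exists (x * y^-1)%g; split.
  apply/negP => /disjointFl/(_ xA); rewrite mem_lcoset invMg invgK mulgKV.
  by rewrite yA.
rewrite disjoint_subset; apply/subsetP => e eA; rewrite inE mem_bd_lcoset.
apply: contra nbad => e'A; apply/imsetP.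
exists (e, ((x * y^-1)^-1 * e.1, e.2)%g); first by rewrite in_setX eA.
by rewrite /= invMg invgK mulKVg.
Qed.

(** For a translate that meets [A], cardinality turns each nesting into an equality, so the
    translate has the same boundary as [A]; but the two boundaries are disjoint and nonempty. *)
Lemma indecomposable_isoperimetry (rels : seq (word S)) A :
  triangular rels -> presents gen rels ->
  indecomposable A -> indecomposable (~: A) ->
  #|A| <= #|~: A| -> #|A| <= #|bd A| ^ 2.
Proof.
move=> tri pres indA indC leA; rewrite leqNgt; apply/negP => lt.
have [g [meet dis]] := exists_translate lt.
have bdU : bd (g *: A)%g <> bd A.
  move=> E; move: dis; rewrite E -setI_eq0 setIid => /eqP/(bd_eq0 pres)[] A0.
    by move: lt; rewrite A0 cards0.
  by move: leA lt; rewrite A0 setCT cards0; lia.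
have indCU : indecomposable (~: (g *: A)%g).
  by rewrite -lcosetC indecomposable_lcoset.
have [|||] := bd_disjoint_nested tri pres indA indC
  (indecomposable_lcoset g indA) indCU dis.
- by apply/negP.
- move=> s; apply: bdU; congr (bd _); apply/eqP.
  by rewrite eqEcard s card_lcoset leqnn.
- move=> s; apply: bdU; congr (bd _); apply/esym/eqP.
  by rewrite eqEcard s card_lcoset leqnn.
(* The complement of the translate has the size of [~: A], which is at least that of [A]. *)
- move=> s; apply: bdU; rewrite -bdC; congr (bd _); apply/eqP.
  by rewrite eqEcard s -lcosetC card_lcoset leA.
Qed.

Lemma isoperimetry (R : rcfType) (rels : seq (word S)) A :
  triangular rels -> presents gen rels ->
  (Num.sqrt (2 / #|gT|%:R) * (minn #|A| #|~: A|)%:R <= #|bd A|%:R :> R)%R.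
Proof.
move=> tri pres; set k := Num.sqrt _.
have k0 : (0 <= k)%R by exact: sqrtr_ge0.
have [c] := ubnP #|bd A|; elim: c A => // c IH A; rewrite ltnS => leA.
case: (posnP (minn #|A| #|~: A|)) => [->|]; first by rewrite mulr0 ler0n.
rewrite leq_min => /andP[A0 C0].
(* [D] stands for [A] or its complement. *)
have split D : bd D = bd A -> #|D| + #|~: D| = #|gT| ->
    minn #|A| #|~: A| = minn #|D| #|~: D| -> ~~ indecomposable D ->
    (k * (minn #|A| #|~: A|)%:R <= #|bd A|%:R)%R.
  move=> E _ ->; rewrite negb_forall => /existsP[B].
  rewrite negb_imply negb_or => /andP[/andP[sB sbd] /andP[B0 BD]].
  (* Both pieces have nonempty boundary, so each boundary is smaller than [bd D] and the induction
     applies. *)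
  have bd_gt0 B' : B' \subset D -> B' != set0 -> B' != D -> 0 < #|bd B'|.
    move=> sB' B'0 B'D; rewrite card_gt0; apply: contra B'0 => /eqP/(bd_eq0 pres)[->//|E'].
    by move: sB' B'D; rewrite E' subTset => /eqP->; rewrite eqxx.
  have cB := bd_gt0 B sB B0 BD.
  have cD : 0 < #|bd (D :\: B)|.
    apply: bd_gt0; first exact: subsetDl.
      by rewrite setD_eq0; apply: contra BD => s; rewrite eqEsubset sB.
    apply: contra B0 => /eqP/setDidPl; rewrite disjoint_sym -setI_eq0.
    by rewrite (setIidPl sB).
  have cE := card_bd_split sB sbd; rewrite E in cE; rewrite cE natrD.
  have h1 := IH B _; have h2 := IH (D :\: B) _.
  apply: le_trans (lerD (h1 _) (h2 _)); [|lia|lia].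
  rewrite -mulrDr ler_wpM2l // -natrD ler_nat.
  have := cardsC D; have := cardsC B; have := cardsC (D :\: B).
  by have := cardsID B D; rewrite (setIidPr sB); lia.
have [indA|/split] := boolP (indecomposable A); last by apply=> //; exact: cardsC.
have [indC|/split] := boolP (indecomposable (~: A)); last first.
  by apply; rewrite ?bdC ?setCK 1?minnC // addnC cardsC.
have sq D : bd D = bd A -> indecomposable D -> indecomposable (~: D) ->
    #|D| <= #|~: D| -> (k * #|D|%:R <= #|bd A|%:R :> R)%R.
  move=> E iD iC le; have := indecomposable_isoperimetry tri pres iD iC le.
  rewrite E => leb.
  have n0 : (0 < #|gT|%:R :> R)%R by rewrite ltr0n -(cardsC A); lia.
  (* Squared, the claim is the product of [#|D| <= #|bd A| ^ 2] and [2 * #|D| <= #|gT|]. *)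
  rewrite -(@ler_pXn2r _ 2) ?nnegrE ?mulr_ge0 // exprMn sqr_sqrtr; last first.
    by rewrite divr_ge0 // ltW.
  rewrite mulrAC ler_pdivrMr // -!natrX -!natrM ler_nat.
  rewrite -(mulnn #|D|) mulnA mulnC leq_mul //.
  by rewrite -(cardsC D) mul2n -addnn leq_add2l.
rewrite minnC /minn; case: ltnP => h.
- by apply: sq; rewrite ?bdC ?setCK // ltnW.
- exact: sq.
Qed.

End Cuts.

Theorem theorem1p2 (R : realType) (gT : finGroupType) (S : finType)
    (gen : S -> gT) (rels : seq (word S))
    (triangular_rels : triangular rels)
    (presents_rels : presents gen rels) :
  ((Num.sqrt (2 / (3 * #|vertex (cayley_graph gen)|%:R)))%:E
     <= cheeger R (cayley_graph gen))%E.
Proof.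
apply: le_ereal_inf_tmp => _ /= [A [A0 AT ->]]; rewrite lee_fin.
have m0 : 0 < minn #|A| #|~: A|.
  rewrite leq_min !card_gt0 A0; apply: contra AT => /eqP h.
  by rewrite -[A]setCK h setC0.
rewrite ler_pdivlMr ?ltr0n //.
(* The inequality just proved has [2 / #|gT|] under the root, which exceeds the required
   [2 / (3 * #|gT|)]. *)
apply: le_trans (isoperimetry R A triangular_rels presents_rels).
rewrite ler_wpM2r ?ler0n // ler_sqrt; last by rewrite divr_ge0.
have n0 : (0 < #|gT|%:R :> R)%R by rewrite ltr0n; apply/card_gt0P; exists 1%g.
rewrite ler_wpM2l // lef_pV2 ?posrE ?mulr_gt0 //=.
by lra.
Qed.
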